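(* Let $M\in\mathrm{PGL}(2,\mathbb Z)$ and let $(x_1,x_2,x_3,x_4)$ be an ordered quadruple of pairwise distinct points of $\mathbb P^1(\mathbb Q)$. (i) One has $$\mathrm{cr}_q\bigl(M(x_1),M(x_2);M(x_3),M(x_4)\bigr)=\mathrm{cr}_{q^{\det(M)}}(x_1,x_2;x_3,x_4).$$ (ii) For every $n\ge0$, the Taylor coefficient $\mathrm{cr}^{(n)}$ satisfies $$\mathrm{cr}^{(n)}\bigl(M(x_1),M(x_2);M(x_3),M(x_4)\bigr)=\det(M)^n\,\mathrm{cr}^{(n)}(x_1,x_2;x_3,x_4).$$
   Context: $\mathbb P^1(\mathbb Q)=\mathbb Q\cup\{\infty\}$, on which $\mathrm{PGL}(2,\mathbb Z)=\mathrm{GL}(2,\mathbb Z)/\{\pm1\}$ acts by fractional-linear transformations; $\det(M)\in\{1,-1\}$ is well defined. **$q$-rationals.** $[\,\cdot\,]_q:\mathbb P^1(\mathbb Q)\to\mathbb P^1(\mathbb Q(q))$ is the unique map with $[0]_q=0$, $[x+1]_q=q[x]_q+1$ and $[-1/x]_q=-1/(q[x]_q)$ for all $x$ (usual conventions for $\infty$; in particular $[\infty]_q=\infty$). For finite $x$, $[x]_q$ is a rational function of $q$, regular at $q=1$ with $[x]_1=x$. **Cross-ratios.** For pairwise distinct points of $\mathbb P^1(\mathbb K)$ with nonzero lifts $X_i\in\mathbb K^2$ and $\Delta_{ij}=\det(X_i,X_j)$, $\mathrm{cr}(x_1,x_2;x_3,x_4)=\frac{\Delta_{13}\Delta_{24}}{\Delta_{14}\Delta_{23}}$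 (equal to $\frac{(x_1-x_3)(x_2-x_4)}{(x_1-x_4)(x_2-x_3)}$ in finite affine coordinates). For pairwise distinct $x_i\in\mathbb P^1(\mathbb Q)$, $\mathrm{cr}_q(x_1,x_2;x_3,x_4)=\mathrm{cr}([x_1]_q,[x_2]_q;[x_3]_q,[x_4]_q)\in\mathbb Q(q)$. The notation $\mathrm{cr}_{q^{-1}}$ means that $q$ is replaced by $q^{-1}$ in this rational function. **Taylor coefficients.** The coefficients $\mathrm{cr}^{(n)}$ are the functions of the quadruple defined by the expansion at $h=0$, with $q=e^h$: $\mathrm{cr}_{e^h}=\sum_{n\ge0}\mathrm{cr}^{(n)}h^n/n!$. *)

(* Defs.v *)
From mathcomp Require Import all_boot all_order all_algebra.
From mathcomp Require Import ring lra.
From mathcomp Require Import reals topology normedtype sequences derive exp.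

Set Implicit Arguments.
Unset Strict Implicit.
Unset Printing Implicit Defensive.

Import Order.TTheory GRing.Theory Num.Theory.
Import numFieldNormedType.Exports.

Local Open Scope ring_scope.
Local Open Scope quotient_scope.

(* The projective line K u {oo}; None is the point at infinity. *)
Definition P1 (K : Type) : Type := option K.

Lemma ord2P (i : 'I_2) : i = 0 \/ i = 1.
Proof. by case: i => [[|[|]]] // ?; [left|right]; apply: val_inj. Qed.

Section ProjectiveLine.
Variable K : fieldType.
Implicit Types (x y : P1 K) (X Y : 'cV[K]_2) (A B : 'M[K]_2).

Definition hlift x : 'cV[K]_2 :=
  \col_i (if x is Some z then (if i == 0 then z else 1) else (i == 0)%:R).

(* The point of the line spanned by X (meaningful for X != 0). *)
Definition proj X : P1 K :=
  if X 1 0 == 0 then None else Some (X 0 0 / X 1 0).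

Definition frac_lin A x : P1 K := proj (A *m hlift x).

Definition Delta X Y : K := \det (row_mx X Y : 'M[K]_2).

Definition cr_lift X1 X2 X3 X4 : K :=
  (Delta X1 X3 * Delta X2 X4) / (Delta X1 X4 * Delta X2 X3).

Definition cr (x1 x2 x3 x4 : P1 K) : K :=
  cr_lift (hlift x1) (hlift x2) (hlift x3) (hlift x4).

(* x |-> a x + b, for a != 0 *)
Definition affine (a b : K) x : P1 K := omap (fun z => a * z + b) x.

(* x |-> - 1 / (a x), for a != 0 *)
Definition neginv (a : K) x : P1 K :=
  if x is Some z then (if z == 0 then None else Some (- (a * z)^-1))
  else Some 0.

Lemma lift_neq0 x : hlift x != 0.
Proof.
case: x => [z|]; apply/eqP => /matrixP.
  by move=> /(_ 1 0); rewrite !mxE /= => /eqP; rewrite oner_eq0.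
by move=> /(_ 0 0); rewrite !mxE /= => /eqP; rewrite oner_eq0.
Qed.

Lemma projZ c X : c != 0 -> proj (c *: X) = proj X.
Proof.
move=> c0; rewrite /proj !mxE mulf_eq0 (negPf c0) /=.
by case: eqP => // _; rewrite -mulf_div divff // mul1r.
Qed.

Lemma liftK : cancel hlift proj.
Proof. by case=> [z|]; rewrite /proj !mxE /= ?oner_eq0 ?divr1 ?eqxx. Qed.

Lemma projK X : X != 0 -> exists2 c, c != 0 & X = c *: hlift (proj X).
Proof.
have ext Y : X 0 0 = Y 0 0 -> X 1 0 = Y 1 0 -> X = Y.
  by move=> e0 e1; apply/colP => i; case: (ord2P i) => ->.
move=> X0; rewrite /proj; case: eqP => [x10|/eqP x10]; last first.
  by exists (X 1 0) => //; apply: ext; rewrite !mxE /= ?mulr1 // mulrC divfK.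
exists (X 0 0); last by apply: ext; rewrite !mxE /= ?mulr1 ?mulr0.
by apply: contraNneq X0 => x00; apply/eqP/ext; rewrite mxE.
Qed.

Lemma DeltaE X Y : Delta X Y = X 0 0 * Y 1 0 - Y 0 0 * X 1 0.
Proof.
have EX i : X i 0 = (row_mx X Y : 'M_2) i 0.
  by rewrite -(row_mxEl X Y i 0); congr (row_mx X Y _ _); apply: val_inj.
have EY i : Y i 0 = (row_mx X Y : 'M_2) i 1.
  by rewrite -(row_mxEr X Y i 0); congr (row_mx X Y _ _); apply: val_inj.
rewrite /Delta !EX !EY; move: (row_mx X Y : 'M_2) => A.
rewrite (expand_det_row _ 0) !big_ord_recl big_ord0 /cofactor !det_mx11 !mxE /=.
rewrite expr0 expr1 mul1r addr0 mulN1r mulrN.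
by congr (A _ _ * A _ _ - A _ _ * A _ _); apply: val_inj.
Qed.

Lemma cr_liftZ c1 c2 c3 c4 X1 X2 X3 X4 :
  c1 != 0 -> c2 != 0 -> c3 != 0 -> c4 != 0 ->
  cr_lift (c1 *: X1) (c2 *: X2) (c3 *: X3) (c4 *: X4) = cr_lift X1 X2 X3 X4.
Proof.
move=> n1 n2 n3 n4; rewrite /cr_lift.
have DZ c d X Y : Delta (c *: X) (d *: Y) = c * d * Delta X Y.
  by rewrite !DeltaE !mxE; ring.
rewrite !DZ.
have -> : c1 * c3 * Delta X1 X3 * (c2 * c4 * Delta X2 X4) =
  (c1 * c2 * c3 * c4) * (Delta X1 X3 * Delta X2 X4) by ring.
have -> : c1 * c4 * Delta X1 X4 * (c2 * c3 * Delta X2 X3) =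
  (c1 * c2 * c3 * c4) * (Delta X1 X4 * Delta X2 X3) by ring.
by rewrite -mulf_div divff ?mul1r // !mulf_neq0.
Qed.

Lemma cr_finite (z1 z2 z3 z4 : K) :
  cr (Some z1) (Some z2) (Some z3) (Some z4) =
  ((z1 - z3) * (z2 - z4)) / ((z1 - z4) * (z2 - z3)).
Proof. by rewrite /cr /cr_lift !DeltaE !mxE /= !mulr1. Qed.

Lemma frac_linE A x : frac_lin A x =
  if x is Some z then
    if A 1 0 * z + A 1 1 == 0 then None
    else Some ((A 0 0 * z + A 0 1) / (A 1 0 * z + A 1 1))
  else if A 1 0 == 0 then None else Some (A 0 0 / A 1 0).
Proof.
have sum2 (F : 'I_2 -> K) : \sum_i F i = F 0 + F 1.
  by rewrite !big_ord_recl big_ord0 addr0; congr (F _ + F _); apply: val_inj.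
rewrite /frac_lin /proj !mxE !sum2 !mxE.
by case: x => [z|]; rewrite /= ?mulr1 ?mulr0 ?addr0.
Qed.

End ProjectiveLine.

Arguments hlift {K} x.
Arguments cr {K} x1 x2 x3 x4.

(* y |-> q^c y + [c]_q, the c-th iterate of y |-> q y + 1 *)
Definition qshift (K : fieldType) (q : K) (c : int) : P1 K -> P1 K :=
  affine (q ^ c) ((q ^ c - 1) / (q - 1)).

Section ShiftTheory.
Variables (K : fieldType) (q : K).
Hypotheses (q0 : q != 0) (q1 : q - 1 != 0).

Lemma qshiftD c d y : qshift q (c + d) y = qshift q c (qshift q d y).
Proof.
case: y => //= y; congr Some; rewrite expfzDr //.
by move: (q ^ c) (q ^ d) => u v; field.
Qed.

Lemma qshift1 y : qshift q 1 y = affine q 1 y.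
Proof. by case: y => //= y; rewrite expr1z divff. Qed.

Lemma qshift0 y : qshift q 0 y = y.
Proof. by case: y => //= y; rewrite expr0z subrr mul0r mul1r addr0. Qed.

Lemma neginv0 (a : K) : neginv a (Some 0) = None.
Proof. by rewrite /= eqxx. Qed.

Lemma neginvK (a : K) : a != 0 -> involutive (neginv a).
Proof.
move=> a0 [y|] /=; last by rewrite eqxx.
case: eqVneq => [->|y0] //=.
rewrite oppr_eq0 invr_eq0 (negPf (mulf_neq0 a0 y0)).
by congr Some; rewrite mulrN invrN opprK [X in X = _]invfM invrK mulKf.
Qed.

Lemma neginv_qshift y :
  neginv q (qshift q 1 (neginv q (qshift q 1 y))) = qshift q (-1) (neginv q y).
Proof.
rewrite !qshift1; case: y => [y|] /=; last first.
  rewrite mulr0 add0r oner_eq0 mulr1 /=; congr Some.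
  by rewrite exprN1; field; rewrite q0 q1.
have [->|y0] := eqVneq y 0.
  by rewrite mulr0 add0r oner_eq0 mulr1 /= mulrN divff // addNr eqxx.
have [e|e] := eqVneq (q * y + 1) 0 => /=.
  congr Some; have -> : y = - q^-1.
    by apply: (mulfI q0); rewrite mulrN divff //; apply/eqP; rewrite -addr_eq0 e.
  by rewrite exprN1; field; rewrite q0 q1 oppr_eq0 oner_eq0.
rewrite mulrN invfM mulrA divff // mul1r.
have -> : - (q * y + 1)^-1 + 1 = q * y / (q * y + 1) by field.
rewrite mulf_eq0 invr_eq0 (negPf e) !mulf_eq0 (negPf q0) (negPf y0) /=.
by congr Some; rewrite exprN1; field; rewrite q0 q1 y0 e.
Qed.

Lemma neginv_one : neginv q (qshift q 1 (Some 0)) = qshift q (-1) (Some 0).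
Proof.
rewrite qshift1 /= mulr0 add0r oner_eq0 mulr1; congr Some.
by rewrite exprN1; field; rewrite q0 q1.
Qed.

End ShiftTheory.

Definition GL2Z : Type := {M : 'M[int]_2 | M \in unitmx}.

Definition eq_sign (M N : GL2Z) : bool :=
  (val M == val N) || (val M == - val N).

Lemma eq_sign_refl : reflexive eq_sign.
Proof. by move=> M; rewrite /eq_sign eqxx. Qed.

Lemma eq_sign_sym : symmetric eq_sign.
Proof. by move=> M N; rewrite /eq_sign eq_sym -eqr_oppLR [- _ == _]eq_sym. Qed.

Lemma eq_sign_trans : transitive eq_sign.
Proof.
move=> N M P; rewrite /eq_sign.
case/orP => /eqP->; case/orP => /eqP->; rewrite ?opprK eqxx ?orbT //.
Qed.

Canonical eq_sign_equiv :=
  EquivRel eq_sign eq_sign_refl eq_sign_sym eq_sign_trans.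

Definition PGL2Z : Type := {eq_quot eq_sign}.

Definition pgl_act (M : PGL2Z) (x : P1 rat) : P1 rat :=
  frac_lin (map_mx intr (val (repr M))) x.

Definition pgl_det (M : PGL2Z) : int := \det (val (repr M)).

Lemma repr_piP (M : GL2Z) :
  val (repr (\pi_PGL2Z M)) = val M \/ val (repr (\pi_PGL2Z M)) = - val M.
Proof.
have /eqmodP : repr (\pi_PGL2Z M) = M %[mod PGL2Z] by rewrite reprK.
by case/orP => /eqP; [left|right].
Qed.

Lemma pgl_act_pi (M : GL2Z) x :
  pgl_act (\pi_PGL2Z M) x = frac_lin (map_mx intr (val M)) x.
Proof.
rewrite /pgl_act; case: (repr_piP M) => -> //.
by rewrite map_mxN /frac_lin mulNmx -scaleN1r projZ // oppr_eq0 oner_eq0.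
Qed.

Lemma pgl_det_pi (M : GL2Z) : pgl_det (\pi_PGL2Z M) = \det (val M).
Proof.
by rewrite /pgl_det; case: (repr_piP M) => -> //; rewrite -scaleN1r detZ sqrrN expr1n mul1r.
Qed.

Lemma pgl_det_sign (M : PGL2Z) : (pgl_det M == 1) || (pgl_det M == -1).
Proof.
have := valP (repr M); rewrite unitmxE -/(pgl_det M) => h.
by have := h; rewrite unfold_in /= => /orP[]/eqP->.
Qed.

Notation Qq := {fraction {poly rat}}.

Definition q : Qq := tofrac 'X.

(* The conditions characterizing [.]_q; they force [oo]_q = oo
   since -1/0 = oo on both sides. *)
Definition is_qbracket (f : P1 rat -> P1 Qq) : Prop :=
  [/\ f (Some 0) = Some 0,
      forall x, f (affine 1 1 x) = affine q 1 (f x)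
    & forall x, f (neginv 1 x) = neginv q (f x)].

(* Every rational is r = c - 1/x' with c = ceil(r) and x' in (1, oo]; the
   recursion follows this (Hirzebruch-Jung) expansion, along which
   denominators strictly decrease, so that denq r + 1 steps suffice. *)
Fixpoint qbracket_fuel (n : nat) (x : P1 rat) : P1 Qq :=
  match n, x with
  | n'.+1, Some r => qshift q (Num.ceil r)
      (neginv q (qbracket_fuel n' (neginv 1 (Some (r - (Num.ceil r)%:~R)))))
  | _, _ => None
  end.

Definition height (x : P1 rat) : nat := if x is Some r then `|denq r|%N else 0%N.

Definition qbracket (x : P1 rat) : P1 Qq := qbracket_fuel (height x).+1 x.

Lemma height_red (r : rat) :
  (height (neginv 1 (Some (r - (Num.ceil r)%:~R))%R) < height (Some r))%N.
Proof.
set c := Num.ceil r; have /andP[cl cr] := ceil_itv r; rewrite -/c in cl cr.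
have dgt0 := denq_gt0 r; rewrite /= /neginv.
case: eqVneq => [_|rc0]; first by rewrite absz_gt0 denq_neq0.
rewrite /height mul1r -invrN opprB.
have d0 : (denq r)%:~R != 0 :> rat by rewrite intr_eq0 denq_neq0.
pose N := c * denq r - numq r.
have NE : c%:~R - r = N%:~R / (denq r)%:~R.
  by rewrite /N rmorphB rmorphM /= numqE; field.
have dq0 : 0 < (denq r)%:~R :> rat by rewrite ltr0z.
have NE' : N%:~R = (c%:~R - r) * (denq r)%:~R by rewrite NE divfK.
have Ngt0 : 0 < N.
  rewrite -(ltr0z rat) NE' mulr_gt0 // subr_gt0 lt_neqAle cr andbT.
  by rewrite -subr_eq0.
have Nlt : N < denq r.
  rewrite -(ltr_int rat) NE' gtr_pMl //.
  by rewrite rmorphB /= in cl; lra.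
have coNd : coprime `|denq r| `|N|.
  have: coprimez (denq r) N.
    rewrite /coprimez /N gcdzMDl gcdzN -/(coprimez _ _).
    by rewrite coprimez_sym coprimezE coprime_num_den.
  by rewrite coprimezE.
rewrite NE invf_div coprimeq_den // gt_eqF //.
by rewrite -ltz_nat !abszE (gtr0_norm (denq_gt0 r)) normr_id gtr0_norm.
Qed.

Lemma qbracket_fuelE n m x : (height x < n)%N -> (height x < m)%N ->
  qbracket_fuel n x = qbracket_fuel m x.
Proof.
elim: n m x => [|n IHn] [|m] [r|] //.
rewrite !ltnS => hn hm /=; congr (qshift _ _ (neginv _ _)).
by apply: IHn; apply: leq_trans (height_red r) _.
Qed.

Lemma qbracketE (r : rat) : qbracket (Some r) = qshift q (Num.ceil r)
  (neginv q (qbracket (neginv 1 (Some (r - (Num.ceil r)%:~R))))).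
Proof.
rewrite {1}/qbracket /=; congr (qshift _ _ (neginv _ _)).
by apply: qbracket_fuelE; rewrite ?height_red.
Qed.

Lemma q_neq0 : q != 0.
Proof. by rewrite tofrac_eq0 polyX_eq0. Qed.

Lemma q_neq1 : q - 1 != 0.
Proof.
rewrite /q -tofrac1 -tofracB tofrac_eq0.
by rewrite -size_poly_eq0 size_XsubC.
Qed.

Lemma qbracket0 : qbracket (Some 0) = Some 0.
Proof. by rewrite qbracketE ceil0 subr0 neginv0 qshift0. Qed.

Lemma qbracket_shift x : qbracket (affine 1 1 x) = affine q 1 (qbracket x).
Proof.
case: x => [r|] //; rewrite -(qshift1 q_neq1) [affine _ _ _]/= mul1r !qbracketE.
have -> : Num.ceil (r + 1) = 1 + Num.ceil r.
  by rewrite (ceilDrz r (rpred1 _)) (intrKceil 1) addrC.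
rewrite (qshiftD q_neq0 q_neq1); congr (qshift _ _ (qshift _ _ (neginv _ (qbracket (neginv _ (Some _)))))).
by rewrite rmorphD /=; ring.
Qed.

Lemma qbracket_neginv_pos n (w : rat) : 0 < w -> (height (Some w) <= n)%N ->
  qbracket (neginv 1 (Some w)) = neginv q (qbracket (Some w)).
Proof.
elim: n w => [|n IHn] w w0.
  by rewrite /height leqn0 absz_eq0 denq_eq0.
move=> hw; have wn0 : w != 0 by rewrite gt_eqF.
have [w1|w1] := ltP 1 w.
  rewrite {1}/neginv (negPf wn0) mul1r [LHS]qbracketE.
  have iw0 : 0 < w^-1 by rewrite invr_gt0.
  have iw1 : w^-1 < 1 by rewrite invf_lt1.
  rewrite (_ : Num.ceil (- w^-1) = 0); last first.
    by apply: ceil_def; apply/andP; split; rewrite ?rmorphB /=; lra.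
  rewrite qshift0 subr0 /neginv oppr_eq0 invr_eq0 (negPf wn0).
  by rewrite mul1r invrN opprK invrK.
have cw : Num.ceil w = 1.
  by apply: ceil_def; apply/andP; split; rewrite ?rmorphB /=; lra.
have := height_red w; rewrite [in RHS]qbracketE cw => hr.
have [we1|wne1] := eqVneq w 1.
  rewrite we1 (_ : neginv 1 (Some 1) = Some (-1)); last first.
    by rewrite /neginv oner_eq0 mul1r invr1.
  rewrite qbracketE (_ : Num.ceil (-1) = -1); last exact: (intrKceil (-1)).
  by rewrite !subrr !neginv0 (neginv_one q_neq0 q_neq1).
have w_lt1 : w < 1 by rewrite lt_neqAle wne1.
have u0 : 1 - w != 0 by rewrite subr_eq0 eq_sym.
have u0' : w - 1 != 0 by rewrite subr_eq0.
pose v := w / (1 - w).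
have v0 : 0 < v by rewrite divr_gt0 ?subr_gt0.
have x'E : neginv 1 (Some (w - 1%:~R)) = affine 1 1 (Some v).
  rewrite /= (negPf u0') /v mul1r; congr Some; field.
  by rewrite u0 u0'.
have hv : (height (Some v) <= n)%N.
  rewrite -ltnS; apply: leq_trans hw.
  suff -> : height (Some v) = height (affine 1 1 (Some v)) by rewrite -x'E -cw height_red.
  rewrite /height /= mul1r; congr `|_|%N.
  rewrite -{2}(divq_num_den v).
  have d0 : (denq v)%:~R != 0 :> rat by rewrite intr_eq0 denq_neq0.
  have -> : (numq v)%:~R / (denq v)%:~R + 1 = (numq v + denq v)%:~R / (denq v)%:~R :> rat.
    by rewrite rmorphD /=; field.
  rewrite coprimeq_den ?denq_eq0 ?normr_denq //.
  have: coprimez (denq v) (numq v + denq v).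
    rewrite /coprimez gcdzDr -/(coprimez _ _).
    by rewrite coprimez_sym coprimezE coprime_num_den.
  by rewrite coprimez_sym coprimezE.
rewrite x'E qbracket_shift -!(qshift1 q_neq1) (neginv_qshift q_neq0 q_neq1).
rewrite -(IHn v v0 hv).
rewrite (_ : qbracket (neginv 1 (Some v)) = qshift q 1 (qbracket (neginv 1 (Some w)))).
  by rewrite -(qshiftD q_neq0 q_neq1) addNr qshift0.
rewrite (qshift1 q_neq1) -qbracket_shift /= (negPf wn0) gt_eqF //=; congr (qbracket (Some _)).
by rewrite /v; field; rewrite wn0 u0.
Qed.

Lemma qbracket_neginv x : qbracket (neginv 1 x) = neginv q (qbracket x).
Proof.
case: x => [r|]; last by rewrite /= qbracket0.
have [r0|r0|->] := ltgtP r 0; last by rewrite qbracket0 /= !eqxx.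
  have rn0 : r != 0 by rewrite lt_eqF.
  have E : neginv 1 (Some r) = Some (- r^-1) by rewrite /= (negPf rn0) mul1r.
  have := @qbracket_neginv_pos _ (- r^-1) _ (leqnn _).
  rewrite -E neginvK ?oner_eq0 // oppr_gt0 invr_lt0 => /(_ r0) ->.
  by rewrite neginvK ?q_neq0.
exact: (qbracket_neginv_pos r0 (leqnn _)).
Qed.

Theorem qbracketP : is_qbracket qbracket.
Proof. by split; [exact: qbracket0|exact: qbracket_shift|exact: qbracket_neginv]. Qed.

Theorem qbracket_unique (f : P1 rat -> P1 Qq) : is_qbracket f -> f =1 qbracket.
Proof.
case=> f0 fshift fneg.
have shiftf (c : int) x : f (affine 1 c%:~R x) = qshift q c (f x).
  have pos (n : nat) y : f (affine 1 n%:~R y) = qshift q n (f y).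
    elim: n y => [|n IHn] y.
      by rewrite qshift0; case: y => //= y; rewrite mul1r addr0.
    rewrite intS (qshiftD q_neq0 q_neq1) -IHn (qshift1 q_neq1) -fshift; congr f.
    by case: y => //= y; congr Some; rewrite rmorphD /=; ring.
  have neg y (n : nat) : f (affine 1 (- n%:Z)%:~R y) = qshift q (- n%:Z) (f y).
    rewrite -[in RHS](_ : affine 1 n%:~R (affine 1 (- n%:Z)%:~R y) = y).
      by rewrite pos -(qshiftD q_neq0 q_neq1) addNr qshift0.
    by case: y => //= y; congr Some; rewrite rmorphN /=; ring.
  case: c => n; first exact: pos.
  by rewrite NegzE neg.
have finf : f None = None.
  by rewrite -(neginv0 (1 : rat)) fneg f0 neginv0.
move=> x; have [n] := ubnP (height x); elim: n x => // n IHn [r|] // hr.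
rewrite qbracketE -IHn; last exact: leq_trans (height_red r) _.
rewrite -fneg neginvK ?oner_eq0 // -shiftf; congr (f (Some _)).
by rewrite mul1r subrK.
Qed.

(* The fraction chosen by [repr] need not be in lowest terms: evaluating its
   numerator and denominator directly could give 0/0 at a regular point. *)
Definition num_red (F : Qq) : {poly rat} :=
  \n_(repr F) %/ gcdp \n_(repr F) \d_(repr F).
Definition den_red (F : Qq) : {poly rat} :=
  \d_(repr F) %/ gcdp \n_(repr F) \d_(repr F).

(* The value F(t), constants being sent to L by iota. *)
Definition feval (L : fieldType) (iota : rat -> L) (t : L) (F : Qq) : L :=
  (map_poly iota (num_red F)).[t] / (map_poly iota (den_red F)).[t].

Lemma red_spec (F : Qq) : [/\ den_red F != 0,
  coprimep (num_red F) (den_red F) & F = tofrac (num_red F) / tofrac (den_red F)].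
Proof.
rewrite /num_red /den_red; set f := repr F.
have d0 : \d_f != 0 by exact: denom_ratioP.
set g := gcdp _ _.
have g0 : g != 0 by rewrite gcdp_eq0 negb_and d0 orbT.
have gn : g %| \n_f by exact: dvdp_gcdl.
have gd : g %| \d_f by exact: dvdp_gcdr.
have dg0 : \d_f %/ g != 0 by rewrite dvdp_div_eq0.
split => //; first by apply: coprimep_div_gcd; rewrite d0 orbT.
apply: (canRL (mulfK _)); first by rewrite tofrac_eq0.
have fE : F * tofrac \d_f = tofrac \n_f.
  rewrite -[F]reprK; unlock FracField.tofrac; rewrite -[LHS]FracField.pi_mul.
  apply/eqmodP; rewrite /= FracField.equivfE /FracField.mulf -/f.
  by rewrite !numden_Ratio ?mulr1 ?mul1r ?oner_neq0 // mulrC.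
have t0 : tofrac g != 0 by rewrite tofrac_eq0.
apply: (mulIf t0).
by rewrite -mulrA -!tofracM !divpK.
Qed.

Lemma feval_frac (L : fieldType) (iota : {rmorphism rat -> L}) (t : L)
    (a b : {poly rat}) : b != 0 -> coprimep a b ->
  feval iota t (tofrac a / tofrac b) = (map_poly iota a).[t] / (map_poly iota b).[t].
Proof.
move=> b0 cab; rewrite /feval; have [d0 cnd] := red_spec (tofrac a / tofrac b).
set n := num_red _ in cnd *; set d := den_red _ in d0 cnd *.
move=> /eqP; rewrite eqr_div ?tofrac_eq0 // -!tofracM tofrac_eq => /eqP adnb.
have bd : b %| d.
  by rewrite -(Gauss_dvdpr _ (_ : coprimep b a)) 1?coprimep_sym // adnb dvdp_mull.
have db : d %| b.
  by rewrite -(Gauss_dvdpr _ (_ : coprimep d n)) 1?coprimep_sym // -adnb dvdp_mull.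
have /eqp_eq E : b %= d by rewrite /eqp bd db.
have ld0 : lead_coef d != 0 by rewrite lead_coef_eq0.
have lb0 : lead_coef b != 0 by rewrite lead_coef_eq0.
pose c := lead_coef d / lead_coef b.
have c0 : c != 0 by rewrite mulf_neq0 ?invr_eq0.
have dE : d = c *: b.
  by apply: (scalerI lb0); rewrite -E scalerA /c mulrCA divff // mulr1.
have nE : n = c *: a.
  by apply: (mulIf b0); rewrite -adnb dE -scalerAl -scalerAr.
by rewrite nE dE !map_polyZ !hornerZ -mulf_div divff ?mul1r // fmorph_eq0.
Qed.

Definition cr_q (x1 x2 x3 x4 : P1 rat) : Qq :=
  cr (qbracket x1) (qbracket x2) (qbracket x3) (qbracket x4).

(* The rational function F with q replaced by G. *)
Definition subst_q (G F : Qq) : Qq := feval (@tofrac _ \o polyC) G F.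

Lemma subst_q_id : subst_q q =1 id.
Proof.
move=> F; have [d0 cnd E] := red_spec F; rewrite [RHS]E /subst_q /feval.
have h (p : {poly rat}) : (map_poly (@tofrac _ \o polyC) p).[q] = tofrac p.
  rewrite map_poly_comp /q horner_map; congr tofrac.
  exact: comp_polyXr.
by rewrite !h.
Qed.

(* The n-th Taylor coefficient at h = 0 of the smooth function
   h |-> cr_{e^h}, normalized as the coefficient of h^n / n!. *)
Definition cr_taylor (R : realType) (n : nat) (x1 x2 x3 x4 : P1 rat) : R :=
  derive1n n (fun h : R => feval ratr (expR h) (cr_q x1 x2 x3 x4)) 0.

(* Main.v *)
(* The map [x |-> -q^-1 [-x]_{q^-1}] satisfies the functional equations of the
   q-rationals, so it equals [[.]_q]: negating [x] acts on [[x]_q] as the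
   substitution of [q^-1] for [q] followed by a homography.  Translation and
   inversion act on [[x]_q] by homographies of P^1(Q(q)).  Cross-ratios are
   invariant under homographies and commute with field automorphisms, which gives
   (i) for generators of PGL(2, Z), hence for all of it by Euclid's algorithm on
   the first column.  For (ii), substituting [q^-1] for [q = e^h] amounts to
   replacing [h] by [-h]. *)

Require Import Defs.
From HB Require Import structures.
From mathcomp Require Import all_boot all_order all_algebra.
From mathcomp Require Import ring.
From mathcomp Require Import boolp classical_sets filter reals topology normedtype.
From mathcomp Require Import sequences derive exp.

Set Implicit Arguments.
Unset Strict Implicit.
Unset Printing Implicit Defensive.

Import Order.TTheory GRing.Theory Num.Theory.
Import numFieldNormedType.Exports.
Local Open Scope classical_set_scope.
Local Open Scope ring_scope.

(** * Invariance of the cross-ratio under homographies and field morphisms *)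

Section CrossRatioInvariance.
Variable K : fieldType.
Implicit Types (A B : 'M[K]_2) (x y : P1 K).

(** An invertible [B] keeps the lift nonzero, so normalizing [B *m hlift x] costs a nonzero scalar.
    It depends on [x], and [cr_liftZ] absorbs it. *)
Lemma frac_lin_lift B x : \det B != 0 ->
  exists2 c, c != 0 & hlift (frac_lin B x) = c *: (B *m hlift x).
Proof.
move=> dB; have uB : B \in unitmx by rewrite unitmxE unitfE.
have : B *m hlift x != 0.
  apply: contra_neq (lift_neq0 x) => e.
  by rewrite -(mulKmx uB (hlift x)) e mulmx0.
case/projK => c c0 e; exists c^-1; first by rewrite invr_eq0.
by rewrite /frac_lin {2}e scalerA mulVf // scale1r.
Qed.

Lemma frac_linM A B x : \det B != 0 ->
  frac_lin (A *m B) x = frac_lin A (frac_lin B x).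
Proof.
case/(frac_lin_lift x) => c c0 e.
by rewrite [in RHS]/frac_lin e -scalemxAr projZ // mulmxA.
Qed.

(** Each [Delta] picks up a factor [\det B], two above and two below the fraction bar. *)
Lemma cr_frac_lin B x1 x2 x3 x4 : \det B != 0 ->
  cr (frac_lin B x1) (frac_lin B x2) (frac_lin B x3) (frac_lin B x4) =
  cr x1 x2 x3 x4.
Proof.
move=> dB; rewrite /cr.
case: (frac_lin_lift x1 dB) => c1 ? ->; case: (frac_lin_lift x2 dB) => c2 ? ->.
case: (frac_lin_lift x3 dB) => c3 ? ->; case: (frac_lin_lift x4 dB) => c4 ? ->.
rewrite cr_liftZ // /cr_lift.
have DM X Y : Delta (B *m X) (B *m Y) = \det B * Delta X Y.
  by rewrite /Delta -mul_mx_row det_mulmx.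
rewrite !DM [X in X / _]mulrACA [X in _ / X]mulrACA -[LHS]mulf_div.
by rewrite divff ?mul1r // mulf_neq0.
Qed.

Definition mx2 (a b c d : K) : 'M[K]_2 :=
  \matrix_(i, j) if i == 0 then (if j == 0 then a else b)
                 else (if j == 0 then c else d).

Lemma det_mx2 a b c d : \det (mx2 a b c d) = a * d - b * c.
Proof.
rewrite (expand_det_row _ 0) !big_ord_recl big_ord0 /cofactor !det_mx11 !mxE /=.
by rewrite expr0 expr1 mul1r addr0 mulN1r mulrN.
Qed.

Lemma affine_id x : affine 1 0 x = x.
Proof. by case: x => //= z; rewrite mul1r addr0. Qed.

Lemma affineE a b : a != 0 -> affine a b =1 frac_lin (mx2 a b 0 1).
Proof.
move=> a0 [z|]; rewrite frac_linE !mxE /= ?eqxx //.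
by rewrite mul0r add0r oner_eq0 divr1.
Qed.

Lemma neginvE a : a != 0 -> neginv a =1 frac_lin (mx2 0 (-1) a 0).
Proof.
move=> a0 [z|]; rewrite frac_linE !mxE /= ?(negPf a0) ?mul0r //.
by rewrite addr0 add0r mulf_eq0 (negPf a0) mulN1r.
Qed.

Lemma cr_affine a b x1 x2 x3 x4 : a != 0 ->
  cr (affine a b x1) (affine a b x2) (affine a b x3) (affine a b x4) =
  cr x1 x2 x3 x4.
Proof.
by move=> a0; rewrite !affineE // cr_frac_lin // det_mx2 mulr1 mulr0 subr0.
Qed.

Lemma cr_neginv a x1 x2 x3 x4 : a != 0 ->
  cr (neginv a x1) (neginv a x2) (neginv a x3) (neginv a x4) =
  cr x1 x2 x3 x4.
Proof.
by move=> a0; rewrite !neginvE // cr_frac_lin // det_mx2 mul0r mulN1r sub0r opprK.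
Qed.

End CrossRatioInvariance.

Lemma cr_omap (K L : fieldType) (s : {rmorphism K -> L}) (x1 x2 x3 x4 : P1 K) :
  cr (omap s x1) (omap s x2) (omap s x3) (omap s x4) = s (cr x1 x2 x3 x4).
Proof.
have hE x : hlift (omap s x) = map_mx s (hlift x).
  apply/colP => i; rewrite !mxE; case: x => [z|] /=; last by rewrite rmorph_nat.
  by case: (_ == _); rewrite ?rmorph1.
by rewrite /cr /cr_lift !hE /Delta -!map_row_mx !det_map_mx fmorph_div !rmorphM.
Qed.

(** * Evaluation of rational functions and reversed polynomials *)

Section Evaluation.
Variables (L : fieldType) (iota : {rmorphism rat -> L}).
Implicit Types (t : L) (a b p : {poly rat}) (F : Qq).
Local Notation "p ^i" := (map_poly iota p) (at level 2, format "p ^i").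

(* [a / b] need not be in lowest terms; at a pole both sides are [x / 0 = 0]. *)
Lemma feval_quot t a b : b != 0 -> ~ (a^i.[t] = 0 /\ b^i.[t] = 0) ->
  feval iota t (tofrac a / tofrac b) = a^i.[t] / b^i.[t].
Proof.
move=> b0 nz; set g := gcdp a b.
have g0 : g != 0 by rewrite gcdp_eq0 negb_and b0 orbT.
have gn : g %| a by exact: dvdp_gcdl.
have gd : g %| b by exact: dvdp_gcdr.
have aE : a = a %/ g * g by rewrite divpK.
have bE : b = b %/ g * g by rewrite divpK.
have gt0 : g^i.[t] != 0.
  apply/eqP => gt; apply: nz.
  by rewrite aE bE !rmorphM !hornerM gt !mulr0.
have t0 : tofrac g != 0 by rewrite tofrac_eq0.
have bg0 : b %/ g != 0 by rewrite dvdp_div_eq0.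
rewrite [in LHS]aE [in LHS]bE !tofracM -mulf_div divff // mulr1.
rewrite feval_frac //; last by apply: coprimep_div_gcd; rewrite b0 orbT.
by rewrite [in RHS]aE [in RHS]bE !rmorphM !hornerM -mulf_div divff // mulr1.
Qed.

(** The reciprocal polynomial [X^N p(1/X)], for a bound [N] on the degree: sharing one [N] between
    numerator and denominator makes the powers of the variable cancel. *)
Definition revp N p : {poly rat} := \poly_(i < N.+1) p`_(N - i).

Lemma revp_eq0 N p : (size p <= N.+1)%N -> (revp N p == 0) = (p == 0).
Proof.
move=> sp; apply/eqP/eqP => [e|->]; last first.
  by apply/polyP => i; rewrite coef_poly !coef0 if_same.
apply/polyP => i; rewrite coef0; have [iN|iN] := leqP i N.
  have /(congr1 (fun r : {poly rat} => r`_(N - i))) := e.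
  by rewrite coef_poly coef0 ltnS leq_subr subKn.
by rewrite nth_default // (leq_trans sp).
Qed.

Lemma horner_revp t N p : t != 0 -> (size p <= N.+1)%N ->
  (revp N p)^i.[t] = t ^+ N * p^i.[t^-1].
Proof.
move=> t0 sp.
rewrite (@horner_coef_wide _ N.+1 (revp N p)^i); last first.
  by rewrite size_map_poly size_poly.
rewrite (@horner_coef_wide _ N.+1 p^i) ?size_map_poly // mulr_sumr.
rewrite (reindex_inj rev_ord_inj) /=; apply: eq_bigr => i _.
have iN : (i <= N)%N by rewrite -ltnS.
rewrite subSS !coef_map coef_poly ltnS leq_subr subKn // mulrCA; congr (_ * _).
by rewrite exprVn -expfB_cond // (negPf t0).
Qed.

End Evaluation.

Lemma horner_q (p : {poly rat}) :
  (map_poly (@tofrac _ \o polyC) p).[q] = tofrac p.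
Proof.
rewrite map_poly_comp /q horner_map; congr tofrac.
exact: comp_polyXr.
Qed.

(** Multiplying by [q^N] turns the value into the polynomial [revp N p] in [q], which is nonzero.
    Hence any fraction, reduced or not, may be evaluated at [q^-1]. *)
Lemma qV_transcendental (p : {poly rat}) : p != 0 ->
  (map_poly (@tofrac _ \o polyC) p).[q^-1] != 0.
Proof.
move=> p0; have sp := leqSpred (size p).
have := horner_revp (@tofrac _ \o polyC) q_neq0 sp.
rewrite horner_q => e; apply: contra_neq p0 => p0.
by move: e; rewrite p0 mulr0 => /eqP; rewrite tofrac_eq0 revp_eq0 // => /eqP.
Qed.

(* The map [y |-> - u^-1 * s y], for [u = q] and [s] the substitution of [q^-1]
   for [q], turns [[x]_q] into [[-x]_q]. *)
Section Twist.
Variables (K : fieldType) (s : {rmorphism K -> K}) (u : K).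
Hypotheses (u0 : u != 0) (su : s u = u^-1).

(** With [T] the twist and [A] the map [y |-> u y + 1], this reads [T = A T A]: [T] conjugates [A]
    to its inverse, as negation does for [x |-> x + 1]. *)
Lemma twist_affine y :
  affine (- u^-1) 0 (omap s y) = affine u 1 (affine (- u^-1) 0 (omap s (affine u 1 y))).
Proof. by case: y => //= z; congr Some; rewrite rmorphD rmorphM rmorph1 su; field. Qed.

Lemma twist_neginv y :
  affine (- u^-1) 0 (omap s (neginv u y)) = neginv u (affine (- u^-1) 0 (omap s y)).
Proof.
case: y => [z|] /=; last by rewrite rmorph0 mulr0 addr0.
have [->|z0] := eqVneq z 0; first by rewrite rmorph0 /= mulr0 addr0 eqxx.
rewrite /= !addr0 mulf_eq0 oppr_eq0 invr_eq0 (negPf u0) fmorph_eq0 (negPf z0) /=.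
congr Some; rewrite rmorphN fmorphV rmorphM su.
have sz : s z != 0 by rewrite fmorph_eq0.
by field; rewrite u0 sz ?oppr_eq0 ?oner_eq0.
Qed.

End Twist.

(** * Substitution of [q^-1] as a field morphism, and negation of [x] *)

Lemma tofrac_surj (F : Qq) : exists a b : {poly rat},
  b != 0 /\ F = tofrac a / tofrac b.
Proof. by have [d0 _ E] := red_spec F; exists (num_red F), (den_red F). Qed.

Local Notation hornerqV p := ((map_poly (@tofrac {poly rat} \o polyC) p).[q^-1]).

Lemma subst_qV_frac (a b : {poly rat}) : b != 0 ->
  subst_q q^-1 (tofrac a / tofrac b) = hornerqV a / hornerqV b.
Proof.
move=> b0; apply: feval_quot => // -[_] /eqP.
exact/negP/qV_transcendental.
Qed.

Lemma subst_qV_zmod_morphism : zmod_morphism (subst_q q^-1).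
Proof.
move=> F G; have [a [b [b0 ->]]] := tofrac_surj F.
have [c [d [d0 ->]]] := tofrac_surj G.
rewrite -mulNr -tofracN addf_div ?tofrac_eq0 // -!tofracM -tofracD.
rewrite !subst_qV_frac ?mulf_neq0 // -mulNr addf_div ?qV_transcendental //.
by rewrite rmorphD !rmorphM rmorphN !(hornerD, hornerN, hornerM).
Qed.

Lemma subst_qV_monoid_morphism : monoid_morphism (subst_q q^-1).
Proof.
split.
  rewrite -[1 in LHS]divr1 -tofrac1 subst_qV_frac ?oner_eq0 //.
  by rewrite rmorph1 hornerC divr1.
move=> F G; have [a [b [b0 ->]]] := tofrac_surj F.
have [c [d [d0 ->]]] := tofrac_surj G.
rewrite mulf_div -!tofracM !subst_qV_frac ?mulf_neq0 // mulf_div.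
by rewrite !rmorphM !hornerM.
Qed.

HB.instance Definition _ :=
  GRing.isZmodMorphism.Build Qq Qq (subst_q q^-1) subst_qV_zmod_morphism.
HB.instance Definition _ :=
  GRing.isMonoidMorphism.Build Qq Qq (subst_q q^-1) subst_qV_monoid_morphism.

Lemma subst_qV_q : subst_q q^-1 q = q^-1.
Proof.
have := @subst_qV_frac 'X 1 (oner_neq0 _).
by rewrite tofrac1 !divr1 map_polyX hornerX rmorph1 hornerC divr1.
Qed.

Lemma is_qbracket_opp : is_qbracket (fun x =>
  affine (- q^-1) 0 (omap (subst_q q^-1) (qbracket (affine (-1) 0 x)))).
Proof.
split.
- have -> : affine (-1) 0 (Some 0) = Some 0 :> P1 rat by rewrite /= mulr0 addr0.
  by rewrite qbracket0 /= rmorph0 mulr0 addr0.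
(* Since [-x = -(x + 1) + 1], the shift rule of [qbracket] at [-(x + 1)] produces the shape [A T A]
   of [twist_affine]. *)
- move=> x; have -> : affine (-1) 0 x = affine 1 1 (affine (-1) 0 (affine 1 1 x)).
    by case: x => //= z; congr Some; ring.
  by rewrite qbracket_shift (twist_affine q_neq0 subst_qV_q).
- move=> x; have -> : affine (-1) 0 (neginv 1 x) = neginv 1 (affine (-1) 0 x).
    case: x => [z|] /=; last by rewrite mulr0 addr0.
    rewrite mulN1r addr0 oppr_eq0; case: eqP => //= _.
    by rewrite mulN1r !mul1r addr0 invrN.
  by rewrite qbracket_neginv (twist_neginv q_neq0 subst_qV_q).
Qed.

Lemma qbracket_opp x :
  qbracket (affine (-1) 0 x) = affine (- q^-1) 0 (omap (subst_q q^-1) (qbracket x)).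
Proof.
(* Uniqueness is applied at [-x], and the double negation cancels. *)
rewrite -(qbracket_unique is_qbracket_opp) /=; congr (affine _ _ (omap _ (qbracket _))).
by case: x => //= z; congr Some; ring.
Qed.

(** * Generators of PGL(2, Z) and Euclid's algorithm *)

Lemma cr_q_opp x1 x2 x3 x4 :
  cr_q (affine (-1) 0 x1) (affine (-1) 0 x2) (affine (-1) 0 x3) (affine (-1) 0 x4) =
  subst_q q^-1 (cr_q x1 x2 x3 x4).
Proof.
rewrite /cr_q !qbracket_opp cr_affine ?oppr_eq0 ?invr_eq0 ?q_neq0 //.
exact: cr_omap.
Qed.

Lemma cr_q_neginv x1 x2 x3 x4 :
  cr_q (neginv 1 x1) (neginv 1 x2) (neginv 1 x3) (neginv 1 x4) = cr_q x1 x2 x3 x4.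
Proof. by rewrite /cr_q !qbracket_neginv cr_neginv // q_neq0. Qed.

Lemma cr_q_shift (k : int) x1 x2 x3 x4 :
  cr_q (affine 1 k%:~R x1) (affine 1 k%:~R x2) (affine 1 k%:~R x3) (affine 1 k%:~R x4) =
  cr_q x1 x2 x3 x4.
Proof.
have shift1 y1 y2 y3 y4 : cr_q (affine 1 1 y1) (affine 1 1 y2) (affine 1 1 y3)
    (affine 1 1 y4) = cr_q y1 y2 y3 y4.
  by rewrite /cr_q !qbracket_shift cr_affine // q_neq0.
have affineS (u v : rat) y : affine 1 u (affine 1 v y) = affine 1 (v + u) y.
  by case: y => //= z; congr Some; ring.
elim: k => [|n IHn|n IHn]; first by rewrite !affine_id.
  by rewrite -addn1 PoszD rmorphD -!affineS shift1.
(* One more shift by 1 turns [-(n + 1)] into [-n]. *)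
rewrite -IHn -[LHS]shift1 !affineS -addn1 PoszD opprD rmorphD /=.
by rewrite rmorphN1 subrK.
Qed.

Lemma mx2M (K : fieldType) (a b c d a' b' c' d' : K) :
  mx2 a b c d *m mx2 a' b' c' d' =
  mx2 (a * a' + b * c') (a * b' + b * d') (c * a' + d * c') (c * b' + d * d').
Proof.
apply/matrixP => i j; rewrite !mxE big_ord_recl big_ord1 !mxE /=.
by case: (ord2P i) => ->; case: (ord2P j) => ->.
Qed.

Definition frac_linz (a b c d : int) : P1 rat -> P1 rat :=
  frac_lin (mx2 a%:~R b%:~R c%:~R d%:~R).

Lemma cr_q_frac_linz (a b c d : int) x1 x2 x3 x4 :
  (a * d - b * c == 1) || (a * d - b * c == -1) ->
  cr_q (frac_linz a b c d x1) (frac_linz a b c d x2)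
       (frac_linz a b c d x3) (frac_linz a b c d x4) =
  subst_q (q ^ (a * d - b * c)) (cr_q x1 x2 x3 x4).
Proof.
have [n] := ubnP `|c|%N; elim: n a b c d => // n IHn a b c d; rewrite ltnS => hc he.
have [c0|c0] := eqVneq c 0.
  move: he; rewrite c0 mulr0 subr0 => he.
  (* Here [d] is an integer unit, hence its own inverse: the map is [z |-> a d z + b d], and [a d]
     is the determinant. *)
  have dd : d * d = 1.
    have : a * d \is a GRing.unit by case/orP: he => /eqP ->.
    by rewrite unitrM => /andP[_ /orP[]/eqP ->].
  have E x : frac_linz a b 0 d x = affine 1 (b * d)%:~R (affine (a * d)%:~R 0 x).
    have ddq : d%:~R * d%:~R = 1 :> rat by rewrite -rmorphM dd.
    have d0 : d%:~R != 0 :> rat.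
      by apply: contra_eq_neq ddq => ->; rewrite mul0r eq_sym oner_eq0.
    rewrite /frac_linz frac_linE !mxE /=; case: x => [z|] //=.
    rewrite mul0r add0r (negPf d0) !rmorphM /=; congr Some.
    have -> : d%:~R^-1 = d%:~R :> rat by apply: (mulfI d0); rewrite mulfV.
    by ring.
  rewrite !E cr_q_shift.
  case/orP: he => /eqP ->; last by rewrite rmorphN1 cr_q_opp exprN1.
  by rewrite expr1z subst_q_id !affine_id.
(* Euclid: [M = T^k S M'], where [T x = x + 1], [S x = -1/x], and the lower left
   entry [-r] of [M'] is smaller than [c]. *)
have [k [r [aE rc]]] : exists k r : int, a = k * c + r /\ (`|r| < `|c|)%N.
  exists (a %/ c)%Z, (a %% c)%Z; split; first exact: divz_eq.
  by rewrite -ltz_nat gez0_abs ?modz_ge0 // ltz_mod.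
(* Forced by the upper right entry of [T^k S M'], which is [k d - b']. *)
pose b' := k * d - b.
have detE : a * d - b * c = c * b' - d * (- r) by rewrite aE /b'; ring.
have E x : frac_linz a b c d x = affine 1 k%:~R (neginv 1 (frac_linz c d (- r) b' x)).
  have d0 : \det (mx2 c%:~R d%:~R (- r)%:~R b'%:~R : 'M[rat]_2) != 0.
    rewrite det_mx2 -!rmorphM -rmorphB /= intr_eq0 -detE.
    by case/orP: he => /eqP ->.
  have dS : \det (mx2 0 (-1) 1 0 : 'M[rat]_2) != 0.
    by rewrite det_mx2 mulN1r mul0r sub0r opprK oner_eq0.
  rewrite /frac_linz neginvE ?oner_eq0 // affineE ?oner_eq0 // -!frac_linM // mx2M mx2M.
  by congr (frac_lin (mx2 _ _ _ _) x);
    rewrite ?aE /b' ?rmorphD ?rmorphB ?rmorphN ?rmorphM /=; ring.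
rewrite !E cr_q_shift cr_q_neginv detE IHn // -?detE //.
by rewrite abszN (leq_trans rc).
Qed.

Lemma cr_q_pgl (M : PGL2Z) x1 x2 x3 x4 :
  cr_q (pgl_act M x1) (pgl_act M x2) (pgl_act M x3) (pgl_act M x4) =
  subst_q (q ^ pgl_det M) (cr_q x1 x2 x3 x4).
Proof.
(* The action and the determinant read the same representative [A], so no choice of sign
   intervenes. *)
have := pgl_det_sign M; rewrite /pgl_act /pgl_det; move: (val _) => A.
have mA : map_mx intr A =
    mx2 (A 0 0)%:~R (A 0 1)%:~R (A 1 0)%:~R (A 1 1)%:~R :> 'M[rat]_2.
  by apply/matrixP => i j; rewrite !mxE; case: (ord2P i) => ->; case: (ord2P j) => ->.
have dA : \det A = A 0 0 * A 1 1 - A 0 1 * A 1 0.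
  apply: (@intr_inj rat); rewrite rmorphB !rmorphM /= -det_mx2 -mA.
  by rewrite det_map_mx.
by rewrite dA mA => /cr_q_frac_linz ->.
Qed.

(** * Evaluation at inverse points and Taylor coefficients *)

Lemma feval_subst_qV (L : fieldType) (iota : {rmorphism rat -> L}) (t : L) (F : Qq) :
  t != 0 -> feval iota t (subst_q q^-1 F) = feval iota t^-1 F.
Proof.
move=> t0; have [d0 cnd E] := red_spec F.
rewrite {1}E subst_qV_frac // /feval.
set a := num_red F in cnd *; set b := den_red F in d0 cnd *.
pose N := maxn (size a) (size b).
have sa : (size a <= N.+1)%N by rewrite leqW // leq_maxl.
have sb : (size b <= N.+1)%N by rewrite leqW // leq_maxr.
have hq (p : {poly rat}) : (size p <= N.+1)%N ->
    hornerqV p = q ^- N * tofrac (revp N p).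
  move=> sp; have := horner_revp (@tofrac _ \o polyC) q_neq0 sp.
  by rewrite horner_q => ->; rewrite mulKf // expf_neq0 // q_neq0.
have unscale (K : fieldType) (c u v : K) : c != 0 -> (c * u) / (c * v) = u / v.
  by move=> c0; rewrite -mulf_div divff // mul1r.
rewrite !hq // unscale ?invr_eq0 ?expf_neq0 ?q_neq0 //.
have tN : t ^+ N != 0 by rewrite expf_neq0.
(* As [N] exceeds both degrees, [X] divides both reversals: their quotient is not reduced, which
   calls for [feval_quot]. *)
rewrite -/(feval iota t _) feval_quot ?revp_eq0 //.
  by rewrite !horner_revp // unscale.
(* As [t != 0], a common zero of the reversals at [t] is a common root of [a] and [b] at [t^-1],
   which coprimality excludes. *)
rewrite !horner_revp // => -[/eqP ha /eqP hb]; move: ha hb.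
rewrite !mulf_eq0 (negPf tN) /= => ha.
by apply/negP/(coprimep_root _ ha); rewrite coprimep_map.
Qed.

Lemma cvg_opp_dnbhs0 (R : realType) : (- x : R) @[x --> (0 : R)^'] --> (0 : R)^'.
Proof.
move=> A [e /= e0 hA]; exists e => // x xe x0.
by apply: hA; rewrite ?oppr_eq0 //= opprK add0r -normrN -(add0r (- x)).
Qed.

(** As an equality of filters, this changes the sign of the variable in a [lim] whether or not the
    limit exists. Negation is an involution, so one inclusion gives the other. *)
Lemma opp_dnbhs0 (R : realType) : (- x : R) @[x --> (0 : R)^'] = (0 : R)^'.
Proof.
apply/seteqP; split=> A hA; last exact: cvg_opp_dnbhs0.
have := @cvg_opp_dnbhs0 R _ hA; rewrite nbhs_simpl /=.
by apply: filterS => x /=; rewrite opprK.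
Qed.

(* No convergence is needed: the [lim] of a divergent filter is [point = 0].
   Hence the derivative lemmas below need no differentiability. *)
Lemma limN_total (R : realType) (T : Type) (F : set_system T) (FF : ProperFilter F)
    (f : T -> R) : lim (- f x @[x --> F]) = - lim (f x @[x --> F]).
Proof.
have [cf|ncf] := pselect (cvg (f x @[x --> F])).
  exact: (@limN R R T F FF f cf).
rewrite (dvgP ncf) oppr0 dvgP //.
by move: ncf; rewrite -(@is_cvgNE R R T F FF f).
Qed.

Lemma derive1N_total (R : realType) (f : R -> R) (a : R) :
  derive1 (fun x => - f x) a = - derive1 f a.
Proof.
rewrite /derive1.
have -> : (fun h => h^-1 *: (- f (h + a) - - f a)) =
    (fun h => - (h^-1 *: (f (h + a) - f a))).
  by apply/funext => h; rewrite -scalerN opprB opprK addrC.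
exact: limN_total.
Qed.

(** Replacing [h] by [-h] turns the difference quotient into minus that of [f] at [-a]. *)
Lemma derive1_reflect (R : realType) (f : R -> R) (a : R) :
  derive1 (fun x => f (- x)) a = - derive1 f (- a).
Proof.
rewrite /derive1.
have -> : (fun h => h^-1 *: (f (- (h + a)) - f (- a))) =
    (fun h => - (h^-1 *: (f (h - a) - f (- a)))) \o -%R.
  by apply/funext => h /=; rewrite invrN scaleNr opprK opprD.
by rewrite fmap_comp opp_dnbhs0; exact: limN_total.
Qed.

Lemma derive1n_reflect (R : realType) (f : R -> R) n :
  derive1n n (fun x => f (- x)) = fun x => (-1) ^+ n * derive1n n f (- x).
Proof.
elim: n => [|n IHn]; first by apply/funext => x; rewrite expr0 mul1r.
rewrite derive1nS IHn; apply/funext => a.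
(* By parity the factor is either 1 or a negation, and [derive1N_total] carries the latter through
   the derivative. *)
rewrite derive1nS -signr_odd -[in RHS]signr_odd /= !mulr_sign.
case: (odd n) => /=; last first.
  by rewrite -derive1_reflect; congr (derive1 _ a); apply/funext => x; rewrite mul1r.
rewrite -[RHS]opprK -derive1_reflect -derive1N_total; congr (derive1 _ a).
by apply/funext => x; rewrite expr1 mulN1r.
Qed.

Theorem theorem1p2 (R : realType) (M : PGL2Z) (x1 x2 x3 x4 : P1 rat)
    (x_distinct : uniq [:: x1; x2; x3; x4]) :
  cr_q (pgl_act M x1) (pgl_act M x2) (pgl_act M x3) (pgl_act M x4) =
    subst_q (q ^ pgl_det M) (cr_q x1 x2 x3 x4)
  /\
  forall n : nat,
    cr_taylor R n (pgl_act M x1) (pgl_act M x2) (pgl_act M x3) (pgl_act M x4) =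
      (pgl_det M)%:~R ^+ n * cr_taylor R n x1 x2 x3 x4.
Proof.
split=> [|n]; first exact: cr_q_pgl.
rewrite /cr_taylor cr_q_pgl; case/orP: (pgl_det_sign M) => /eqP ->.
  by rewrite expr1z subst_q_id rmorph1 expr1n mul1r.
rewrite exprN1 rmorphN1.
have -> : (fun h : R => feval ratr (expR h) (subst_q q^-1 (cr_q x1 x2 x3 x4))) =
    (fun h => feval ratr (expR (- h)) (cr_q x1 x2 x3 x4)).
  by apply/funext => h; rewrite feval_subst_qV ?gt_eqF ?expR_gt0 // expRN.
by rewrite (derive1n_reflect (fun h => feval ratr (expR h) _)) oppr0.
Qed.
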